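(* Let $\mathcal{I}$ and $\mathcal{K}$ be ideals on $\mathbb{N}$. If $X$ is a semi-Lindelöf topological space and each sequence in $X$ has an $\mathcal{S}$-$\mathcal{I}^{\mathcal{K}}$-cluster point, then $X$ is a semi-compact space.
   Context: An ideal on $\mathbb{N}$ is a collection of subsets of $\mathbb{N}$ closed under finite unions and under taking subsets; throughout, ideals on $\mathbb{N}$ are proper (do not contain $\mathbb{N}$) and admissible (contain all finite subsets of $\mathbb{N}$). For an ideal $\mathcal{I}$, $\mathcal{I}^*=\{A\subset\mathbb{N}:\mathbb{N}\setminus A\in\mathcal{I}\}$. A subset $O$ of a topological space $X$ is semi-open if there is an open set $U$ with $U\subset O\subset\overline{U}$; $SO(X)$ is the collection of semi-open subsets of $X$. $X$ is semi-compact if every cover of $X$ by semi-open sets has a finite subcover, and semi-Lindelöf if every cover of $X$ by semi-open sets has a countable subcover. A point $p\in X$ is an $\mathcal{S}$-$\mathcal{I}^{\mathcal{K}}$-cluster point of a sequence $\{x_n\}$ in $X$ if there exists $M\in\mathcal{I}^*$ such that for every $U\in SO(X)$ containing $p$ we have $\{n\in M: x_n\in U\}\notin\mathcal{K}$. *)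

(* Defs.v *)
From HB Require Import structures.
From mathcomp Require Import all_boot all_order all_algebra.
From mathcomp Require Import boolp classical_sets functions cardinality.
From mathcomp Require Import topology.

Set Implicit Arguments.
Unset Strict Implicit.
Unset Printing Implicit Defensive.

Local Open Scope classical_set_scope.

(* Proper admissible ideals on the natural numbers.  Closure under finite
   unions is split into the empty union and binary unions. *)
Record is_ideal (I : set (set nat)) : Prop := IsIdeal {
  ideal0 : I set0 ;
  idealU : forall A B, I A -> I B -> I (A `|` B) ;
  idealS : forall A B, A `<=` B -> I B -> I A ;
  ideal_proper : ~ I [set: nat] ;
  ideal_admissible : forall A, finite_set A -> I A }.

Definition dual_filter (I : set (set nat)) : set (set nat) :=
  [set A | I (~` A)].

Definition semi_open (X : topologicalType) (O : set X) : Prop :=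
  exists U : set X, [/\ open U, U `<=` O & O `<=` closure U].

Definition semi_open_cover (X : topologicalType) (C : set (set X)) : Prop :=
  C `<=` @semi_open X /\ \bigcup_(O in C) O = [set: X].

Definition semi_compact (X : topologicalType) : Prop :=
  forall C : set (set X), semi_open_cover C ->
  exists D : set (set X),
    [/\ D `<=` C, finite_set D & \bigcup_(O in D) O = [set: X]].

Definition semi_lindelof (X : topologicalType) : Prop :=
  forall C : set (set X), semi_open_cover C ->
  exists D : set (set X),
    [/\ D `<=` C, countable D & \bigcup_(O in D) O = [set: X]].

Definition SIK_cluster_point (I K : set (set nat)) (X : topologicalType)
    (x : nat -> X) (p : X) : Prop :=
  exists2 M : set nat, dual_filter I M &
    forall U : set X, semi_open U -> U p -> ~ K [set n | M n /\ U (x n)].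

(* Main.v *)
Require Import Defs.
From HB Require Import structures.
From mathcomp Require Import all_boot all_order all_algebra.
From mathcomp Require Import boolp classical_sets functions cardinality.
From mathcomp Require Import topology.

(** Let [D] be a countable subcover of a semi-open cover, and number its members
    by an injection [g] into nat.  If no finite part of [D] covers [X], then for each [n]
    some point [x n] avoids all members of [D] of index at most [n].  A cluster
    point [p] of [x] lies in some [O] in [D]; but [x n] is in [O] only for
    [n < g O], hence for finitely many [n], and [K] contains the finite sets. *)

Local Open Scope classical_set_scope.

Lemma ideal_bounded (K : set (set nat)) (A : set nat) (m : nat) :
  is_ideal K -> A `<=` `I_m -> K A.
Proof.
by move=> hK Am; apply: (idealS hK Am); apply: (ideal_admissible hK).
Qed.

(** The members of [D] are numbered by [g]; each of them contains only terms of
    [x] of index below its own number. *)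
Lemma escaping_sequence (X : Type) (D : set (set X)) :
  countable D ->
  (forall E, E `<=` D -> finite_set E -> \bigcup_(O in E) O <> [set: X]) ->
  exists (x : nat -> X) (g : set X -> nat),
    forall O n, D O -> O (x n) -> (n < g O)%N.
Proof.
move=> /countable_injP[g ginj] ncov.
have /choice[x xP] : forall n, exists y : X,
    ~ (\bigcup_(O in D `&` g @^-1` `I_n.+1) O) y.
  move=> n; apply/existsNP => cov.
  apply: (ncov (D `&` g @^-1` `I_n.+1)); first exact: subIsetl.
    have Einj : {in D `&` g @^-1` `I_n.+1 &, injective g}.
      by move=> A B /set_mem[DA _] /set_mem[DB _]; apply: ginj; exact/mem_set.
    rewrite -(eq_finite_set (inj_card_eq Einj)).
    by apply: sub_finite_set (finite_II n.+1) => _ [O [_ gO] <-].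
  by apply/seteqP; split=> // y _; exact: cov.
exists x, g => O n DO Oxn; rewrite ltnNge; apply/negP => gOn.
by apply: (xP n); exists O.
Qed.

Theorem theorem3p12 (I K : set (set nat)) (X : topologicalType)
    (hI : is_ideal I) (hK : is_ideal K)
    (hX : semi_lindelof X)
    (hcl : forall x : nat -> X, exists p : X, SIK_cluster_point I K x p) :
  semi_compact X.
Proof.
move=> C covC; have [D [DC cD covD]] := hX C covC.
apply: contrapT => nfin.
have [|x [g xg]] := @escaping_sequence X D cD.
  move=> E ED finE covE; apply: nfin; exists E; split=> //.
  exact: subset_trans DC.
have [p [M _ clp]] := hcl x.
have [O DO Op] : (\bigcup_(O in D) O) p by rewrite covD.
apply: (clp O _ Op); first by apply: covC.1; apply: DC.
by apply: (@ideal_bounded K _ (g O) hK) => n [_ Oxn]; exact: xg.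
Qed.
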